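(* Let $a,b$ be real numbers with $a>0$, $b\neq 0$ and $a^2>4b^2$. For $N\ge1$ let $L^*$ be the $N\times N$ tridiagonal matrix with $L^*_{i,j}=a$ if $i=j$, $L^*_{i,j}=b$ if $|i-j|=1$, and $L^*_{i,j}=0$ otherwise. Then $L^*$ is positive definite, and there exist two positive numbers $c_1,c_2$ depending only on $a$ and $b$ (not on $N$) such that $$0<\inf_{H\in\mathcal S_{[N]}:\ \|H\|_F=1} -\mathrm{d}^2\Phi(L^* )(H,H)\le c_1e^{-c_2N},$$ where $\Phi=\Phi_{L^*}$ is the expected log-likelihood function.
   Context: Notation: $[N]=\{1,\dots,N\}$; $\mathcal S_{[N]}$ is the space of real symmetric $N\times N$ matrices and $\mathcal S_{[N]}^{++}$ its open subset of positive definite matrices; $\|\cdot\|_F$ is the Frobenius norm. For a matrix $A$ and $J\subset[N]$, $A_J$ is the principal submatrix indexed by $J$, with $\det A_\emptyset=1$. For $L\in\mathcal S_{[N]}^{++}$ and $J\subset[N]$, $p_J(L)=\det(L_J)/\det(I+L)$ (the probability mass function of the determinantal point process with kernel $L$). Expected log-likelihood: for $L\in\mathcal S_{[N]}^{++}$, $\Phi_{L^*}(L)=\sum_{J\subset[N]}p_J(L^* )\log\det(L_J)-\log\det(I+L)$. $\mathrm{d}^2\Phi(L^* )$ denotes its second derivative at $L^*$, a symmetric bilinear form on $\mathcal S_{[N]}$. *)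

(* Defs.v *)
From HB Require Import structures.
From mathcomp Require Import all_boot all_order all_algebra.
From mathcomp Require Import sesquilinear ring.
From mathcomp Require Import all_classical all_reals all_analysis.

Set Implicit Arguments.
Unset Strict Implicit.
Unset Printing Implicit Defensive.

Import Order.TTheory GRing.Theory Num.Theory.
Import numFieldNormedType.Exports.

Local Open Scope classical_set_scope.
Local Open Scope ring_scope.

Section FrobeniusNorm.
Variables (R : realType) (N : nat).
Implicit Types A B : 'M[R]_N.

Definition frobenius_norm A : R := Num.sqrt (\sum_i \sum_j A i j ^+ 2).

Lemma frobenius_normE A :
  frobenius_norm A = Num.sqrt (\sum_(p : 'I_N * 'I_N) A p.1 p.2 ^+ 2).
Proof. by rewrite /frobenius_norm pair_bigA. Qed.

Lemma sum_cauchy_schwarz (I : finType) (x y : I -> R) :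
  (\sum_i x i * y i) ^+ 2 <= (\sum_i x i ^+ 2) * (\sum_i y i ^+ 2).
Proof.
set C := \sum_i _; set A := \sum_i _; set B := \sum_i _.
have B0 : 0 <= B by apply: sumr_ge0 => i _; exact: sqr_ge0.
have key : 0 <= B * (A * B - C ^+ 2).
  have -> : B * (A * B - C ^+ 2) = \sum_i (B * x i - C * y i) ^+ 2.
    rewrite (eq_bigr (fun i => B ^+ 2 * x i ^+ 2 + (- (2 * B * C)) * (x i * y i)
      + C ^+ 2 * y i ^+ 2)) => [|i _]; last by ring.
    by rewrite !big_split /= -!mulr_sumr -/A -/B -/C; ring.
  by apply: sumr_ge0 => i _; exact: sqr_ge0.
have [B_gt0|] := ltP 0 B; first by move: key; rewrite pmulr_rge0// subr_ge0.
move=> /(conj B0)/andP/le_anti B00.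
have y0 i : y i = 0.
  have /eqP := esym B00; rewrite psumr_eq0 => [/allP/(_ i)|j _]; last exact: sqr_ge0.
  by rewrite mem_index_enum => /(_ isT); rewrite sqrf_eq0 => /eqP.
rewrite /C big1 => [|i _]; first by rewrite expr0n /= -B00 mulr0.
by rewrite y0 mulr0.
Qed.

Lemma ler_frobenius_normD A B :
  frobenius_norm (A + B) <= frobenius_norm A + frobenius_norm B.
Proof.
rewrite !frobenius_normE; set a := \sum_p A _ _ ^+ 2; set b := \sum_p B _ _ ^+ 2.
have a0 : 0 <= a by apply: sumr_ge0 => i _; exact: sqr_ge0.
have b0 : 0 <= b by apply: sumr_ge0 => i _; exact: sqr_ge0.
rewrite -(ler_pXn2r (ltn0Sn 1)) ?nnegrE ?addr_ge0 ?sqrtr_ge0//.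
rewrite sqrrD !sqr_sqrtr//; last by apply: sumr_ge0 => i _; exact: sqr_ge0.
under eq_bigr => p _ do rewrite mxE sqrrD.
rewrite !big_split /= -/a -/b lerD2r lerD2l -mulr2n lerMn2r /=.
rewrite -sqrtrM// (le_trans (ler_norm _))// -sqrtr_sqr; apply: ler_wsqrtr.
exact: sum_cauchy_schwarz.
Qed.

Lemma frobenius_normZ (l : R) A :
  frobenius_norm (l *: A) = `|l| * frobenius_norm A.
Proof.
rewrite !frobenius_normE -sqrtr_sqr -sqrtrM ?sqr_ge0//; congr Num.sqrt.
by rewrite mulr_sumr; apply: eq_bigr => p _; rewrite mxE exprMn.
Qed.

Lemma frobenius_norm_eq0 A : frobenius_norm A = 0 -> A = 0.
Proof.
rewrite frobenius_normE => /eqP; rewrite sqrtr_eq0 => le0.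
have /eqP : \sum_(p : 'I_N * 'I_N) A p.1 p.2 ^+ 2 = 0.
  by apply/le_anti; rewrite le0 sumr_ge0// => i _; exact: sqr_ge0.
rewrite psumr_eq0 => [/allP h|p _]; last exact: sqr_ge0.
apply/matrixP => i j; rewrite mxE.
by have := h (i, j); rewrite mem_index_enum sqrf_eq0 => /(_ isT)/eqP.
Qed.

End FrobeniusNorm.

(* The space of real symmetric matrices, as a normed space in its own right, so
   that differentials are taken in that space rather than in 'M[R]_N. *)
Definition sym_pred (R : realType) (N : nat) : {pred 'M[R]_N} :=
  fun A => A \is symmetricmx.

Record sym_matrix (R : realType) (N : nat) := SymMatrix {
  sym_val :> 'M[R]_N;
  sym_valP : sym_val \in @sym_pred R N }.
Arguments SymMatrix {R N} _ _.

HB.instance Definition _ R N := [isSub for @sym_val R N].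
HB.instance Definition _ R N := [Choice of sym_matrix R N by <:].

Section SymMatrixSpace.
Variables (R : realType) (N : nat).

Lemma sym_predE (A : 'M[R]_N) : (A \in @sym_pred R N) = (A == A^T).
Proof.
rewrite -topredE /= /sym_pred is_hermitianmxE expr0 scale1r.
by congr (_ == _); apply/matrixP => i j; rewrite !mxE.
Qed.

Fact sym_submod_closed : submod_closed (@sym_pred R N).
Proof.
split=> [|l A B]; rewrite !sym_predE ?trmx0// => /eqP A1 /eqP B1.
by rewrite linearP /= -A1 -B1.
Qed.

HB.instance Definition _ :=
  GRing.isSubmodClosed.Build R 'M[R]_N (@sym_pred R N) sym_submod_closed.
HB.instance Definition _ := [SubChoice_isSubLmodule of sym_matrix R N by <:].

Let frob (A : sym_matrix R N) := frobenius_norm A.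

Fact ler_frobD A B : frob (A + B) <= frob A + frob B.
Proof. exact: ler_frobenius_normD. Qed.

Fact frobZ (l : R) A : frob (l *: A) = `|l| * frob A.
Proof. exact: frobenius_normZ. Qed.

Fact frob_eq0 A : frob A = 0 -> A = 0.
Proof. by move=> /frobenius_norm_eq0 A0; apply/val_inj. Qed.

HB.instance Definition _ :=
  Lmodule_isNormed.Build R (sym_matrix R N) ler_frobD frobZ frob_eq0.

Lemma sym_normE (A : sym_matrix R N) : `|A| = frobenius_norm A.
Proof. by []. Qed.

End SymMatrixSpace.

Section ExpectedLogLikelihood.
Variables (R : realType) (N : nat).
Implicit Types (A : 'M[R]_N) (L : sym_matrix R N) (J : {set 'I_N}).

Definition posdefmx A : Prop :=
  A \is symmetricmx /\ forall x : 'cV[R]_N, x != 0 -> 0 < (x^T *m A *m x) 0 0.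

Definition principal_submx A J : 'M[R]_#|J| :=
  mxsub (@enum_val _ (mem J)) (@enum_val _ (mem J)) A.

Definition dpp_pmf L J : R :=
  \det (principal_submx L J) / \det (1%:M + (L : 'M[R]_N)).

(* Only meaningful where L is positive definite: [ln] is 0 on nonpositive
   reals. The differentials below only see L near a positive definite matrix. *)
Definition expected_loglik (Lstar L : sym_matrix R N) : R :=
  \sum_(J : {set 'I_N}) dpp_pmf Lstar J * ln (\det (principal_submx L J))
  - ln (\det (1%:M + (L : 'M[R]_N))).

End ExpectedLogLikelihood.

(* Iterated Frechet differential d^2 f(x)(h, k). Since ['d] is a total operator
   (0 where f is not differentiable), this is the second derivative
   wherever f is twice differentiable. *)
Definition second_diff (R : realType) (V : normedModType R) (f : V -> R)
  (x h k : V) : R := 'd (fun y => 'd f y k) x h.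

Section Tridiagonal.
Variables (R : realType) (N : nat) (a b : R).

Definition tridiag_mx : 'M[R]_N :=
  \matrix_(i, j) if i == j then a
                 else if (i.+1 == j :> nat) || (j.+1 == i :> nat) then b else 0.

Fact tridiag_mx_sym : tridiag_mx \in @sym_pred R N.
Proof.
by rewrite sym_predE; apply/eqP/matrixP => i j; rewrite !mxE eq_sym orbC.
Qed.

Definition tridiag : sym_matrix R N := SymMatrix tridiag_mx tridiag_mx_sym.

End Tridiagonal.

(* Main.v *)
(* Write f_J(L) = det(L_J) and X_J = tr(L_J^-1 H_J), the logarithmic derivative
   of f_J in the direction H. Since det(1 + L) = sum_J f_J(L), the second
   derivatives of the minors cancel in d^2 Phi(L), which leaves
   - d^2 Phi(L)(H, H) = Var(X_J), where J has law p_J(L).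

   Lower bound: X_set0 = 0, so every X_J, hence every d f_J(L)(H), is bounded by
   a multiple of the standard deviation. For J = [i, j] the derivative
   d f_J(L)(H) is a combination of the H_kl with |k - l| < j - i and of H_ij,
   the latter with a nonzero coefficient (a cofactor of L_J); by induction on
   j - i all entries of H are controlled by the standard deviation.

   Upper bound: take H supported on the two corners (1, N) and (N, 1). If J
   misses some index, L_J splits into blocks separating 1 from N, or J does not
   contain both, so X_J = 0. For J = [N], solving L z = e_N row by row gives
   (a/2) |z_k| <= |b| |z_(k+1)|, so X_J decays like (2 |b| / a)^N. *)
From HB Require Import structures.
Require Import Defs.
From mathcomp Require Import all_boot all_order all_algebra.
From mathcomp Require Import perm ring zify.
From mathcomp Require Import all_classical all_reals all_analysis.
Import Order.TTheory GRing.Theory Num.Theory.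
Import numFieldNormedType.Exports.
Local Open Scope classical_set_scope.
Local Open Scope ring_scope.

Set Implicit Arguments.
Unset Strict Implicit.
Unset Printing Implicit Defensive.

(** * Differential calculus *)

(** The closed form of the first differential is known only near the base point, where the minors
    are positive. A first-order expansion is local, so it passes from [f] to [g], and uniqueness
    identifies the differential. *)
Lemma near_eq_is_diff (R : realType) (V W : normedModType R) (f g df : V -> W)
    (x : V) :
  (\forall y \near x, f y = g y) -> is_diff x f df -> is_diff x g df.
Proof.
move=> fg [fx <-].
have cd := diff_continuous fx.
have fgx : f x = g x by exact: nbhs_singleton fg.
have H : g \o shift x = cst (g x) + 'd f x +o_0 id.
  apply/eqaddoP => e e0.
  have /eqaddoP/(_ e e0) := diff_locally fx.
  have := fg; rewrite (near_shift 0 x) subr0 => fg0.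
  by apply: filterS2 fg0 => y /= fgy; rewrite !fctE /= fgx fgy.
have gd : 'd g x = 'd f x :> (V -> W) by exact: diff_unique.
split=> //.
apply/diff_locallyP; rewrite gd; split=> //.
Qed.

Section calculus.
Context {R : realType} {V : normedModType R}.
Implicit Types (x : V).

Lemma is_diff_sumf (I : Type) (r : seq I) (P : pred I) (f df : I -> V -> R) x :
  (forall i, is_diff x (f i) (df i)) ->
  is_diff x (fun y => \sum_(i <- r | P i) f i y)
            (fun h => \sum_(i <- r | P i) df i h).
Proof.
move=> fx; elim: r => [|i r IH].
  under eq_fun do rewrite big_nil; under [X in is_diff _ _ X]eq_fun do rewrite big_nil.
  exact: is_diff_cst.
under eq_fun do rewrite big_cons; under [X in is_diff _ _ X]eq_fun do rewrite big_cons.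
case: (P i) => //.
exact: is_diffD.
Qed.

Lemma is_diff_prodf (I : eqType) (r : seq I) (f df : I -> V -> R) x :
  uniq r -> (forall i, is_diff x (f i) (df i)) ->
  is_diff x (fun y => \prod_(i <- r) f i y)
    (fun h => \sum_(k <- r) df k h * \prod_(i <- r | i != k) f i x).
Proof.
move=> + fx; elim: r => [_|j r IH /= /andP[jr ur]].
  under eq_fun do rewrite big_nil; under [X in is_diff _ _ X]eq_fun do rewrite big_nil.
  exact: is_diff_cst.
under eq_fun do rewrite big_cons.
apply: is_diff_eq; first exact: (is_diffM (fx j) (IH ur)).
apply/funext => h; rewrite !fctE /GRing.scale /= big_cons addrC big_cons eqxx /=.
congr (_ + _).
  rewrite mulrC; congr (_ * _).
  rewrite [LHS]big_seq_cond [RHS]big_seq_cond; apply: eq_bigl => i.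
  by rewrite andbT; case ir: (i \in r) => //=; apply/esym; apply: contraNneq jr => <-.
rewrite mulr_sumr.
rewrite [LHS]big_seq [RHS]big_seq; apply: eq_bigr => k kr.
rewrite big_cons; have -> : j != k by apply: contraNneq jr => ->.
by rewrite mulrCA.
Qed.

Lemma is_diff_lnf (f df : V -> R) x : 0 < f x -> is_diff x f df ->
  is_diff x (fun y => ln (f y)) (fun h => df h / f x).
Proof.
move=> fx0 fd.
have lnd : is_diff (f x) (@ln R) ( *:%R^~ (f x)^-1).
  have [dl vl] := @is_derive1_ln R _ fx0.
  have dl' := (derivable1_diffP _ _).1 dl.
  by split => //; rewrite diff1E // derive1E vl.
exact: (is_diff_eq (is_diff_comp fd lnd)).
Qed.

Lemma is_diff_divf (f g df dg : V -> R) x : g x != 0 ->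
  is_diff x f df -> is_diff x g dg ->
  is_diff x (fun y => f y / g y)
            (fun h => df h / g x - f x * dg h / g x ^+ 2).
Proof.
move=> gx0 fd [gd gE].
have vd : is_diff x (fun y => (g y)^-1) (fun h => - (dg h / g x ^+ 2)).
  split; first exact: differentiableV.
  rewrite diffV// gE; apply/funext => h /=.
  by rewrite /GRing.scale /= mulrC mulrN.
apply: (is_diff_eq (is_diffM fd vd)); apply/funext => h.
by rewrite !fctE /GRing.scale /= mulrN mulrA addrC mulrC.
Qed.

End calculus.
(** Both sides are the determinant of [A] with row [k] replaced by [v]: Laplace expansion along that
    row on the left, the Leibniz formula on the right. *)
Lemma sum_cofactor_perm (K : comNzRingType) n (A : 'M[K]_n) (k : 'I_n) (v : 'I_n -> K) :
  \sum_l v l * cofactor A k l =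
  \sum_(s : 'S_n) (-1) ^+ s * (v (s k) * \prod_(i | i != k) A i (s i)).
Proof.
pose B := \matrix_(i, j) if i == k then v j else A i j.
transitivity (\det B).
  rewrite (expand_det_row B k); apply: eq_bigr => l _; rewrite mxE eqxx; congr (_ * _).
  rewrite /cofactor; congr (_ * \det _); apply/matrixP => i j.
  by rewrite !mxE eq_sym (negbTE (neq_lift k i)).
apply: eq_bigr => s _; congr (_ * _).
rewrite (bigD1 k) //= mxE eqxx; congr (_ * _).
by apply: eq_bigr => i ik; rewrite mxE (negbTE ik).
Qed.

Section determinant.
Context {R : realType} {V : normedModType R}.

(** Jacobi's formula: the product rule in each Leibniz term, regrouped into cofactors. *)
Lemma is_diff_det n (A dA : 'I_n -> 'I_n -> V -> R) (x : V) :
  (forall i j, is_diff x (A i j) (dA i j)) ->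
  is_diff x (fun y => \det (\matrix_(i, j) A i j y))
    (fun h => \sum_k \sum_l dA k l h * cofactor (\matrix_(i, j) A i j x) k l).
Proof.
move=> Ax; rewrite /determinant.
have Hs (s : 'S_n) : is_diff x
    (fun y => (-1) ^+ s * \prod_i (\matrix_(i, j) A i j y) i (s i))
    (fun h => (-1) ^+ s * \sum_k dA k (s k) h * \prod_(i | i != k) A i (s i) x).
  under eq_fun => y do under eq_bigr => i _ do rewrite mxE.
  exact/is_diffZ/is_diff_prodf/index_enum_uniq.
apply: is_diff_eq; first exact: is_diff_sumf Hs.
apply/funext => h.
under [RHS]eq_bigr do rewrite sum_cofactor_perm.
rewrite exchange_big /=; apply: eq_bigr => s _.
rewrite mulr_sumr; apply: eq_bigr => k _; congr (_ * (_ * _)).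
by apply: eq_bigr => i _; rewrite mxE.
Qed.

End determinant.

Section coordinates.
Context {R : realType} {N : nat}.

Lemma sym_coord_le_norm (x : sym_matrix R N) (i j : 'I_N) :
  `|sym_val x i j| <= `|x|.
Proof.
rewrite sym_normE frobenius_normE -sqrtr_sqr ler_wsqrtr//.
by rewrite (bigD1 (i, j)) //= lerDl sumr_ge0// => p _; exact: sqr_ge0.
Qed.

Lemma is_diff_sym_coord (x : sym_matrix R N) (i j : 'I_N) :
  is_diff x (fun y : sym_matrix R N => sym_val y i j)
            (fun h => sym_val h i j).
Proof.
pose f (y : sym_matrix R N) := sym_val y i j.
have lf : linear f by move=> k u v; rewrite /f /= !mxE.
pose F : {linear sym_matrix R N -> R} := HB.pack f
  (GRing.isLinear.Build _ _ _ _ f lf).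
have cF : continuous F.
  apply: bounded_linear_continuous; exists 1; split; first exact: num_real.
  move=> M M1; apply/nbhs_norm0P; exists 1 => //= y /ltW y1.
  by apply: (le_trans (sym_coord_le_norm y i j)); apply: le_trans (ltW M1).
have dF := linear_differentiable x cF.
have vF := diff_lin x cF.
by split.
Qed.
End coordinates.

(* The second derivatives of the f_i do not appear: at x the weights p_i make
   their contributions to the two logarithmic terms cancel. *)
Lemma second_diff_cross_entropy (R : realType) (V : normedModType R)
    (I : finType) (i0 : I) (f : I -> V -> R) (df : I -> V -> V -> R) (x h : V) :
  (forall i, 0 < f i x) ->
  (forall i y, is_diff y (f i) (df i y)) ->
  (forall i, differentiable (fun y => df i y h) x) ->
  let p i := f i x / \sum_j f j x in
  let X i := df i x h / f i x in
  second_diff (fun y => \sum_i p i * ln (f i y) - ln (\sum_i f i y)) x h h =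
  - (\sum_i p i * X i ^+ 2 - (\sum_i p i * X i) ^+ 2).
Proof.
move=> f0 fd dfd' p X.
pose d2f i : V -> R := 'd (fun y => df i y h) x.
have dfd i : is_diff x (fun y => df i y h) (d2f i) by [].
have sum_gt0 y : (forall i, 0 < f i y) -> 0 < \sum_i f i y.
  move=> fy0; rewrite (bigD1 i0) //= ltr_pwDl// sumr_ge0// => i _; exact: ltW.
pose G y := \sum_i p i * (df i y h / f i y) - (\sum_i df i y h) / \sum_i f i y.
have near_pos : \forall y \near x, forall i, 0 < f i y.
  apply: filter_forall => i.
  have [dx _] := fd i x.
  have := differentiable_continuous dx => /cvgr_gt; exact.
(* The rule for the logarithm applies only where every [f i] is positive, so the closed form holds
   near [x] only. *)
have GE : \forall y \near x, G y = 'd (fun y => \sum_i p i * ln (f i y) - ln (\sum_i f i y)) y h.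
  apply: filterS near_pos => y fy0.
  have dl i : is_diff y (fun z => p i * ln (f i z)) (fun k => p i * (df i y k / f i y)).
    exact/is_diffZ/is_diff_lnf.
  have [_ ->] := is_diffB (is_diff_sumf (index_enum I) predT dl)
     (is_diff_lnf (sum_gt0 _ fy0) (is_diff_sumf (index_enum I) predT (fun i => fd i y))).
  by [].
have dG1 i : is_diff x (fun y => p i * (df i y h / f i y))
    (fun k => p i * (d2f i k / f i x - df i x h * df i x k / f i x ^+ 2)).
  by apply/is_diffZ/is_diff_divf => //; rewrite gt_eqF.
have Sx0 := sum_gt0 _ f0.
have Sx0' : \sum_i f i x != 0 by rewrite gt_eqF.
have dG2 := is_diff_divf Sx0' (is_diff_sumf (index_enum I) predT dfd)
  (is_diff_sumf (index_enum I) predT (fun i => fd i x)).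
have dG := is_diffB (is_diff_sumf (index_enum I) predT dG1) dG2.
have [_ ] := near_eq_is_diff GE dG.
rewrite /second_diff => ->.
rewrite !fctE /=.
set D := \sum_i f i x in p G GE Sx0 Sx0' dG1 dG2 dG *.
have -> : \sum_i p i * X i = (\sum_i df i x h) / D.
  rewrite mulr_suml; apply: eq_bigr => i _; rewrite /p /X.
  by have := f0 i; move/lt0r_neq0 => fi0; field; rewrite fi0 Sx0'.
(* As [p i / f i x = 1 / D], the second derivatives gather into the very term that the quotient rule
   produces, with opposite sign, for the second logarithm. *)
have -> : \sum_i p i * (d2f i h / f i x - df i x h * df i x h / f i x ^+ 2) =
   (\sum_i d2f i h) / D - \sum_i p i * X i ^+ 2.
  rewrite mulr_suml -sumrB; apply: eq_bigr => i _; rewrite /p /X.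
  by have := f0 i; move/lt0r_neq0 => fi0; field; rewrite fi0 Sx0'.
by field.
Qed.

(** * Principal minors and positive definite matrices *)

(** Sylvester's identity: multiplying [P] by the same unipotent block matrix on the left or on the
    right makes it block triangular, with one of the two determinants each time. *)
Lemma det_1DmulmxC (K : comNzRingType) m n (A : 'M[K]_(m, n)) (B : 'M[K]_(n, m)) :
  \det (1%:M + A *m B) = \det (1%:M + B *m A).
Proof.
pose P := block_mx 1%:M (- A) B 1%:M.
have e1 : block_mx 1%:M A 0 1%:M *m P = block_mx (1%:M + A *m B) 0 B 1%:M.
  by rewrite mulmx_block !mul1mx !mul0mx mulmx1 !add0r addNr.
have e2 : P *m block_mx 1%:M A 0 1%:M = block_mx 1%:M 0 B (1%:M + B *m A).
  by rewrite mulmx_block !mul1mx !mulmx1 !mulmx0 !addr0 subrr addrC.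
transitivity (\det P).
  move: (congr1 (fun M => \det M) e1).
  by rewrite det_mulmx det_ublock det_lblock !det1 !mul1r mulr1.
move: (congr1 (fun M => \det M) e2).
by rewrite det_mulmx det_ublock det_lblock !det1 !mul1r mulr1.
Qed.

(* Has the same determinant as the principal submatrix of A indexed by J, but
   keeps the index type 'I_N. *)
Definition pad_mx (K : nzRingType) N (J : {set 'I_N}) (A : 'M[K]_N) : 'M[K]_N :=
  \matrix_(i, j) if (i \in J) && (j \in J) then A i j else (i == j)%:R.

Section principal.
Context {R : realType} {N : nat}.
Implicit Types (A : 'M[R]_N) (J : {set 'I_N}).

Let sel J : 'M[R]_(#|J|, N) := \matrix_(k, i) (enum_val k == i)%:R.

Let ind J : 'rV[R]_N := \row_i (i \in J)%:R.

Let sel_trK J : sel J *m (sel J)^T = 1%:M.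
Proof.
apply/matrixP => k l; rewrite !mxE (bigD1 (enum_val k)) //= !mxE eqxx mul1r.
rewrite big1 ?addr0 => [|i]; first by rewrite (inj_eq enum_val_inj) eq_sym.
by rewrite mxE eq_sym => /negbTE ->; rewrite mul0r.
Qed.

Let tr_selK J : (sel J)^T *m sel J = diag_mx (ind J).
Proof.
apply/matrixP => i j; rewrite !mxE.
under eq_bigr do rewrite !mxE.
rewrite -(big_enum_val (A := mem J) (fun m : 'I_N => (m == i)%:R * (m == j)%:R)) /=.
have [iJ|iJ] := boolP (i \in J).
  rewrite (bigD1 i) //= eqxx mul1r big1 ?addr0 => [|k /andP[_ /negbTE ->]]; last by rewrite mul0r.
  by case: (i == j).
rewrite mul0rn big1 // => k kJ; case: eqP => [ki|_]; last by rewrite mul0r.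
by rewrite -ki kJ in iJ.
Qed.

(** [sel J] picks the rows in [J]. The shape 1 + X Y, available since [sel J] times its transpose is
    1, is the one that [det_1DmulmxC] transforms. *)
Let principal_submxE A J :
  principal_submx A J = 1%:M + (sel J *m (A - 1%:M)) *m (sel J)^T.
Proof.
have H n (B : 'M[R]_(N, n)) k j : (sel J *m B) k j = B (enum_val k) j.
  rewrite mxE (bigD1 (enum_val k)) //= mxE eqxx mul1r big1 ?addr0// => i.
  by rewrite mxE eq_sym => /negbTE ->; rewrite mul0r.
apply/matrixP => k l; rewrite -mulmxA [in RHS]mxE H !mxE.
rewrite (bigD1 (enum_val l)) //= !mxE eqxx mulr1 big1 ?addr0 => [|i il].
  by rewrite (inj_eq enum_val_inj) addrCA subrr addr0.
by rewrite !mxE [enum_val l == i]eq_sym (negbTE il) mulr0.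
Qed.

Lemma det_principal_submx A J :
  \det (principal_submx A J) = \det (pad_mx J A).
Proof.
have -> : pad_mx J A = 1%:M + (sel J)^T *m (sel J *m (A - 1%:M) *m ((sel J)^T *m sel J)).
  rewrite !mulmxA -(mulmxA _ _ (sel J)) tr_selK mul_diag_mx mul_mx_diag.
  apply/matrixP => i j; rewrite !mxE.
  case: (i \in J); case: (j \in J); rewrite /= ?mul1r ?mulr1 ?mul0r ?mulr0 ?addr0 //.
  by rewrite addrC subrK.
by rewrite det_1DmulmxC -!mulmxA sel_trK mulmx1 principal_submxE mulmxA.
Qed.

(** Row i of 1 + A is a unit vector plus row i of A. Multilinearity gives a sum over the set J of
    rows taken from A, and Sylvester's identity turns each term into a principal minor. *)
Lemma det_1D_sum_principal A :
  \det (1%:M + A) = \sum_J \det (principal_submx A J).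
Proof.
transitivity (\sum_(J : {set 'I_N}) \det (1%:M + diag_mx (ind J) *m (A - 1%:M))).
  rewrite /determinant exchange_big /=; apply: eq_bigr => s _.
  rewrite -mulr_sumr; congr (_ * _).
  under eq_bigr do rewrite mxE addrC.
  rewrite bigA_distr; apply: eq_bigr => J _; apply: eq_bigr => i _.
  rewrite mul_diag_mx !mxE; case: (i \in J); rewrite ?mul1r ?mul0r ?addr0 //.
  by rewrite addrC subrK.
apply: eq_bigr => J _.
by rewrite -tr_selK -mulmxA det_1DmulmxC principal_submxE.
Qed.

End principal.

Section posdef.
Context {R : realType} {N : nat}.
Implicit Types (A : 'M[R]_N) (J : {set 'I_N}).

Lemma posdefmx_ker A (x : 'cV[R]_N) : posdefmx A -> (x^T *m A *m x) 0 0 = 0 -> x = 0.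
Proof.
move=> [_ Apos] xAx; apply/eqP; apply/negPn/negP => /Apos.
by rewrite xAx ltxx.
Qed.

Lemma det_posdefmx_neq0 A : posdefmx A -> \det A != 0.
Proof.
move=> Apos; apply/negP => /eqP dA.
have : ~~ (A \in unitmx) by rewrite unitmxE dA unitr0.
rewrite -unitmx_tr -row_free_unit -kermx_eq0 => /rowV0Pn[v /sub_kermxP vA v0].
have /(posdefmx_ker Apos) vT : (v^T^T *m A *m v^T) 0 0 = 0.
  by rewrite -mulmxA -[A]trmxK -trmx_mul vA trmx0 mulmx0 mxE.
by move: v0; rewrite -[v]trmxK vT trmx0 eqxx.
Qed.

Lemma posdefmx_convex1 A (t : R) : posdefmx A -> 0 <= t <= 1 ->
  posdefmx ((1 - t)%:M + t *: A).
Proof.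
move=> [As Apos] /andP[t0 t1]; split.
  have : A \in @sym_pred R N by exact: As.
  rewrite sym_predE => /eqP AT.
  have : ((1 - t)%:M + t *: A) \in @sym_pred R N.
    by rewrite sym_predE linearD /= tr_scalar_mx linearZ /= -AT.
  exact.
move=> x x0; rewrite mulmxDr mulmxDl mul_mx_scalar -scalemxAl -scalemxAr -scalemxAl.
rewrite !mxE.
have xx : 0 < \sum_j x^T 0 j * x j 0.
  rewrite lt_def sumr_ge0 ?andbT => [|j _]; last by rewrite mxE -expr2 sqr_ge0.
  apply: contra x0; rewrite psumr_eq0 => [/allP H|j _]; last by rewrite mxE -expr2 sqr_ge0.
  apply/eqP/matrixP => j k; rewrite ord1 !mxE.
  have := H j; rewrite mem_index_enum => /(_ isT).
  by rewrite mxE -expr2 sqrf_eq0 => /eqP.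
have := Apos x x0; rewrite mxE.
have [->|tn0] := eqVneq t 0; first by rewrite subr0 mul1r mul0r addr0.
move=> Ax; apply: ltr_wpDl; first by rewrite mulr_ge0 ?subr_ge0 ?(ltW xx).
by rewrite mulr_gt0 // lt_def tn0.
Qed.

(** Along the segment from 1 to A the determinant is a polynomial in t, equal to 1 at t = 0. If it
    were nonpositive at t = 1, some positive definite matrix on the segment would be singular. *)
Lemma det_posdefmx_gt0 A : posdefmx A -> 0 < \det A.
Proof.
move=> Apos; rewrite lt_def det_posdefmx_neq0 //= leNgt; apply/negP => dA.
pose p := \det ((1 - 'X)%:M + 'X *: map_mx polyC A).
have pE t : p.[t] = \det ((1 - t)%:M + t *: A).
  rewrite /p -horner_evalE -det_map_mx; congr (\det _).
  apply/matrixP => i j; rewrite [LHS]mxE !mxE.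
  transitivity (((1 - 'X) *+ (i == j) + 'X * (A i j)%:P).[t]); first by [].
  by rewrite hornerD hornerMn !hornerE.
(* [poly_ivt] expects a passage from nonpositive to nonnegative values, hence [- p]. *)
have [|t] := @poly_ivt R (- p) 0 1 ler01.
  by rewrite !hornerN !pE subr0 scale0r addr0 det1 subrr scale1r raddf0 add0r oppr_le0 oppr_ge0 ler01 ltW.
move=> t01; rewrite rootN /root pE; apply/negP.
exact/det_posdefmx_neq0/posdefmx_convex1.
Qed.

(** The quadratic form splits into that of A at the restriction y of x to J, plus the sum of squares
    of x outside J. If y = 0, the second part is positive. *)
Lemma posdefmx_pad A J : posdefmx A -> posdefmx (pad_mx J A).
Proof.
move=> [As Apos].
have /eqP AT : A == A^T by rewrite -sym_predE.
split.
  have : pad_mx J A \in @sym_pred R N; last by [].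
  rewrite sym_predE; apply/eqP/matrixP => i j; rewrite !mxE andbC (eq_sym i).
  by rewrite [in LHS]AT mxE.
move=> x x0.
pose y : 'cV[R]_N := \col_i if i \in J then x i 0 else 0.
have -> : (x^T *m pad_mx J A *m x) 0 0 =
    (y^T *m A *m y) 0 0 + \sum_(i | i \notin J) x i 0 ^+ 2.
  rewrite -!mulmxA !mxE [X in _ = _ + X]big_mkcond -big_split /=; apply: eq_bigr => i _.
  rewrite !mxE; case: ifPn => iJ /=; last first.
    rewrite mul0r add0r (bigD1 i) //= !mxE (negbTE iJ) /= eqxx mul1r big1 ?addr0 ?expr2// => j ji.
    by rewrite !mxE (negbTE iJ) /= eq_sym (negbTE ji) mul0r.
  rewrite addr0; congr (_ * _); apply: eq_bigr => j _; rewrite !mxE iJ /=.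
  case: ifPn => jJ //; rewrite mulr0; case: eqP => [ij|_]; last by rewrite mul0r.
  by rewrite -ij iJ in jJ.
have [y0|yn0] := eqVneq y 0; last first.
  by rewrite ltr_wpDr ?Apos// sumr_ge0// => i _; exact: sqr_ge0.
rewrite y0 mulmx0 mxE add0r lt_def sumr_ge0 ?andbT => [|i _]; last exact: sqr_ge0.
apply: contra x0; rewrite psumr_eq0 => [/allP H|i _]; last exact: sqr_ge0.
apply/eqP/matrixP => i j; rewrite ord1 [in RHS]mxE.
have [iJ|iJ] := boolP (i \in J).
  by move/matrixP: y0 => /(_ i 0); rewrite !mxE iJ.
by have := H i; rewrite mem_index_enum iJ sqrf_eq0 => /(_ isT)/eqP.
Qed.

End posdef.

(** * Cofactors of tridiagonal matrices *)

Section tridiagonal.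
Context {R : realType} {a b : R}.
Hypotheses (ha : 0 < a) (hb : b != 0) (hab : 4 * b ^+ 2 < a ^+ 2).

Let b_lt_half : `|b| < a / 2.
Proof.
rewrite -(ltr_pXn2r (ltn0Sn 1)) ?nnegrE ?divr_ge0 ?(ltW ha)// real_normK ?num_real//.
by rewrite expr_div_n ltr_pdivlMr// mulrC (_ : 2 ^+ 2 = 4)// -natrX.
Qed.

Lemma tridiag_mxE N (i j : 'I_N) : tridiag_mx N a b i j =
  a * (i == j)%:R + b * (j.+1 == i :> nat)%:R + b * (i.+1 == j :> nat)%:R.
Proof.
rewrite mxE; have [<-|ij] := eqVneq i j.
  by rewrite gtn_eqF// mulr1 !mulr0 !addr0.
have [e|_] /= := eqVneq i.+1 (j : nat).
  by rewrite -e gtn_eqF ?ltnS// mulr1 !mulr0 !add0r.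
by case: eqVneq; rewrite ?mulr1 !mulr0 ?addr0 ?add0r.
Qed.

(** Diagonal dominance: each row has at most two neighbours and |x_i x_j| is at most (x_i^2 + x_j^2)
    / 2, so the form is at least (a - 2|b|) times the squared norm of x. *)
Lemma tridiag_posdef N : posdefmx (tridiag N a b).
Proof.
split; first exact: sym_valP.
move=> x x0.
have sub1 (P : pred 'I_N) : (forall i j, P i -> P j -> i = j) -> \sum_j (P j)%:R <= 1 :> R.
  move=> Pinj; case: (pickP P) => [j Pj|P0].
    rewrite (bigD1 j) //= Pj big1 ?addr0// => k kj; case: (boolP (P k)) => // Pk.
    by rewrite (Pinj k j) ?eqxx in kj.
  by rewrite big1 ?ler01// => j _; rewrite P0.
pose adj (i j : 'I_N) : R := (j.+1 == i :> nat)%:R + (i.+1 == j :> nat)%:R.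
have adj2 i : \sum_j adj i j <= 2.
  rewrite big_split /= -[2]/(1 + 1) lerD// sub1 => // j k.
    by move=> /eqP jk /eqP; rewrite -jk => -[] /val_inj.
  by move=> /eqP jk /eqP; rewrite jk => /val_inj.
have adjC i j : adj i j = adj j i by rewrite /adj addrC.
have -> : (x^T *m tridiag N a b *m x) 0 0 = \sum_i \sum_j x i 0 * tridiag_mx N a b i j * x j 0.
  rewrite -mulmxA mxE; apply: eq_bigr => i _; rewrite !mxE mulr_sumr; apply: eq_bigr => j _.
  by rewrite -mulrA.
have xx : 0 < \sum_i x i 0 ^+ 2.
  rewrite lt_def sumr_ge0 ?andbT => [|j _]; last by rewrite sqr_ge0.
  apply: contra x0; rewrite psumr_eq0 => [/allP H|j _]; last by rewrite sqr_ge0.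
  apply/eqP/matrixP => j k; rewrite ord1 !mxE.
  have := H j; rewrite mem_index_enum => /(_ isT).
  by rewrite sqrf_eq0 => /eqP.
apply: (@lt_le_trans _ _ (a * \sum_i x i 0 ^+ 2 - `|b| * \sum_i \sum_j adj i j * x i 0 ^+ 2)).
  rewrite subr_gt0; apply: (@le_lt_trans _ _ (`|b| * \sum_i 2 * x i 0 ^+ 2)).
    rewrite ler_wpM2l// ler_sum// => i _; rewrite -mulr_suml.
    by rewrite ler_wpM2r// sqr_ge0.
  by rewrite -mulr_sumr mulrA ltr_pM2r// -ltr_pdivlMr.
(* Symmetrising in i and j lets the two sums be compared term by term. *)
have -> : \sum_i \sum_j adj i j * x i 0 ^+ 2 =
   \sum_i \sum_j adj i j * ((x i 0 ^+ 2 + x j 0 ^+ 2) / 2).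
  set S := LHS; have SE : S = \sum_i \sum_j adj i j * x j 0 ^+ 2.
    rewrite /S exchange_big /=; apply: eq_bigr => i _; apply: eq_bigr => j _.
    by rewrite adjC.
  have -> : S = (S + S) / 2 by field.
  rewrite {2}SE /S -big_split /= mulr_suml; apply: eq_bigr => i _.
  rewrite -big_split /= mulr_suml; apply: eq_bigr => j _.
  by rewrite -mulrDr mulrA.
rewrite !mulr_sumr -sumrB; apply: ler_sum => i _.
have -> : a * x i 0 ^+ 2 = \sum_j a * (i == j)%:R * x i 0 * x j 0.
  rewrite (bigD1 i) //= eqxx big1 ?addr0 => [|j]; first by rewrite mulr1 -mulrA.
  by rewrite eq_sym => /negbTE ->; rewrite mulr0 !mul0r.
rewrite mulr_sumr -sumrB; apply: ler_sum => j _.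
rewrite tridiag_mxE -addrA -mulrDr -/(adj i j).
have adj0 : 0 <= adj i j by rewrite addr_ge0.
rewrite [leRHS](_ : _ = a * (i == j)%:R * x i 0 * x j 0 + adj i j * (b * x i 0 * x j 0)); last by ring.
rewrite lerD2l mulrCA -mulrN ler_wpM2l// lerNl.
apply: le_trans (ler_norm _) _; rewrite normrN -mulrA normrM ler_wpM2l// normrM.
rewrite ler_pdivlMr// -(real_normK (num_real (x i 0))) -(real_normK (num_real (x j 0))).
rewrite -subr_ge0 (_ : _ - _ = (`|x i 0| - `|x j 0|) ^+ 2) ?sqr_ge0//; ring.
Qed.

(** Propagates growth along the recurrence: |b| < a/2 gives |b u| <= (a/2)|v|, so w keeps at least
    half of a v. Here w is minus b times the next entry, or the determinant in the last row. *)
Lemma tridiag_step (u v w : R) :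
  a / 2 * `|u| <= `|b| * `|v| -> b * u + a * v = w -> a / 2 * `|v| <= `|w|.
Proof.
move=> uv <-.
have r0 : 0 < a / 2 by rewrite divr_gt0.
have bu : `|b| * `|u| <= a / 2 * `|v|.
  rewrite -(ler_pM2l r0) mulrCA; apply: le_trans (ler_wpM2l (normr_ge0 b) uv) _.
  rewrite (mulrA `|b|) (mulrA (a / 2)); apply: ler_wpM2r => //.
  by apply: ler_pM => //; exact: ltW b_lt_half.
have := lerB_dist (a * v) (- (b * u)); rewrite opprK normrN !normrM (gtr0_norm ha) (addrC (a * v)).
apply: le_trans; rewrite lerBrDr; apply: le_trans (lerD (lexx _) bu) _.
by rewrite -mulrDl -splitr.
Qed.

Section interval.
Variables (N : nat) (i j : 'I_N).
Hypothesis ij : (i <= j)%N.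

Let J : {set 'I_N} := [set k : 'I_N | (i <= k <= j)%N].

Let M := pad_mx J (tridiag_mx N a b).

(* W k.+1 is the entry k of column j of the adjugate, restricted to J; the
   shift by one makes W k meaningful for the predecessor of row 0. *)
Let W (m : nat) : R := \sum_(l | (l \in J) && (l.+1 == m :> nat)) cofactor M j l.

Let WS (k : 'I_N) : k \in J -> W k.+1 = cofactor M j k.
Proof.
move=> kJ; rewrite /W (big_pred1 k) // => l; rewrite eqSS /=.
case: (eqVneq l k) => [->|lk]; first by rewrite kJ eqxx.
by rewrite -[l == k :> nat]/(val l == val k) val_eqE (negbTE lk) andbF.
Qed.

(** With [W_high], the boundary conditions: thanks to the shift, [W i] and [W j.+2] stand for the
    entries just before row i and just after row j, so one recurrence covers all rows of J. *)
Let W_low : W i = 0.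
Proof.
rewrite /W big_pred0// => l; rewrite inE; apply/negP => /andP[/andP[il _] /eqP li].
by rewrite -li ltnn in il.
Qed.

Let W_high : W j.+2 = 0.
Proof.
rewrite /W big_pred0// => l; rewrite inE; apply/negP => /andP[/andP[_ lj] /eqP[li]].
by rewrite li ltnn in lj.
Qed.

(** Entry (k, j) of M times its adjugate. *)
Let W_row (k : 'I_N) : k \in J ->
  b * W k + a * W k.+1 + b * W k.+2 = \det M * (k == j)%:R.
Proof.
move=> kJ; rewrite mulr_natr.
have := mul_mx_adj M => /matrixP/(_ k j); rewrite !mxE => <-.
rewrite /W !mulr_sumr [in LHS]big_mkcond [X in _ + X + _]big_mkcond.
rewrite [X in _ + _ + X]big_mkcond.
rewrite -!big_split /=; apply: eq_bigr => l _; rewrite !mxE kJ /=.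
case: (boolP (l \in J)) => lJ /=; last first.
  rewrite !addr0; case: eqP => [kl|_]; last by rewrite mul0r.
  by rewrite -kl kJ in lJ.
have := tridiag_mxE k l; rewrite mxE => ->; rewrite !eqSS.
have -> : (l == k :> nat) = (k == l) by rewrite eq_sym.
rewrite (eq_sym (l : nat)).
by case: (k == l); case: (l.+1 == k :> nat); case: (k.+1 == l :> nat); rewrite /=; ring.
Qed.

Let inJ (k : 'I_N) : (i <= k)%N -> (k <= j)%N -> k \in J.
Proof. by move=> ik kj; rewrite inE ik. Qed.

(** If the first entry of the column vanished, the recurrence, solved for the next entry since b is
    nonzero, would make every entry vanish. Row j would then give det M = 0. *)
Lemma tridiag_cofactor_neq0 : cofactor M j i != 0.
Proof.
apply/negP => /eqP c0.
have W0 m : (i + m <= j)%N -> W (i + m) = 0 /\ W (i + m).+1 = 0.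
  elim: m => [|m IH] mj; first by rewrite addn0 W_low WS ?inJ// c0.
  have mj' : (i + m < j)%N by rewrite addnS in mj.
  have [Wm Wm1] := IH (ltnW mj').
  have kN : (i + m < N)%N by exact: ltn_trans mj' (ltn_ord j).
  rewrite addnS; split => //.
  have := @W_row (Ordinal kN) (inJ _ _); rewrite /= Wm Wm1 leq_addr (ltnW mj').
  rewrite -val_eqE /= (ltn_eqF mj') !mulr0 !add0r => /(_ isT isT)/eqP.
  by rewrite mulf_eq0 (negbTE hb) => /eqP.
have [Wj Wj1] := W0 (j - i)%N (eq_leq (subnKC ij)).
rewrite subnKC// in Wj Wj1.
have := W_row (inJ ij (leqnn j)); rewrite Wj Wj1 W_high eqxx !mulr0 !addr0 mulr1.
move=> /esym/eqP; apply/negP.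
exact/det_posdefmx_neq0/posdefmx_pad/tridiag_posdef.
Qed.

(** Each of the j - i steps up the column gains a factor (a/2)/|b|; the last row compares its entry
    with det M. *)
Lemma tridiag_cofactor_le :
  (a / 2) ^+ (j - i).+1 * `|cofactor M j i| <= `|b| ^+ (j - i) * `|\det M|.
Proof.
have r0 : 0 < a / 2 by rewrite divr_gt0.
have Wle m : (i + m <= j)%N -> a / 2 * `|W (i + m)| <= `|b| * `|W (i + m).+1|.
  elim: m => [|m IH] mj; first by rewrite addn0 W_low normr0 mulr0 mulr_ge0.
  have mj' : (i + m < j)%N by rewrite addnS in mj.
  have kN : (i + m < N)%N by exact: ltn_trans mj' (ltn_ord j).
  rewrite addnS -normrM -[leRHS]normrN.
  apply: tridiag_step (IH (ltnW mj')) _; apply/eqP; rewrite -addr_eq0.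
  have := @W_row (Ordinal kN) (inJ _ _); rewrite /= leq_addr (ltnW mj').
  by rewrite -val_eqE /= (ltn_eqF mj') mulr0 => /(_ isT isT)/eqP.
have Wpow m : (i + m <= j)%N -> (a / 2) ^+ m * `|W i.+1| <= `|b| ^+ m * `|W (i + m).+1|.
  elim: m => [|m IH] mj; first by rewrite addn0.
  have mj' : (i + m < j)%N by rewrite addnS in mj.
  rewrite !exprS -mulrA; apply: le_trans (ler_wpM2l (ltW r0) (IH (ltnW mj'))) _.
  rewrite mulrCA -[leRHS]mulrA (mulrCA `|b|) ler_wpM2l ?exprn_ge0//.
  by rewrite -addnS Wle.
rewrite -(WS (inJ (leqnn i) ij)) exprS -mulrA.
have := Wpow (j - i)%N (eq_leq (subnKC ij)).
move=> /(ler_wpM2l (ltW r0)) /le_trans; apply.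
rewrite mulrCA ler_wpM2l ?exprn_ge0// subnKC//.
(* Row j has no next entry; its right-hand side det M accounts for the extra factor a/2. *)
have := Wle (j - i)%N (eq_leq (subnKC ij)); rewrite subnKC// => /tridiag_step; apply.
have := W_row (inJ ij (leqnn j)); rewrite W_high eqxx mulr0 addr0 mulr1.
exact.
Qed.

End interval.

(** Cut column l of the adjugate to the rows above m. Since m is missing from J, these rows are
    decoupled from the others, and l is not among them. So z^T M z = 0, and positive definiteness
    gives z = 0. *)
Lemma tridiag_cofactor_gap N (J : {set 'I_N}) (k m l : 'I_N) :
  m \notin J -> (k < m)%N -> (m < l)%N ->
  cofactor (pad_mx J (tridiag_mx N a b)) l k = 0.
Proof.
move=> mJ km ml; set M := pad_mx _ _.
have Mpos : posdefmx M by exact/posdefmx_pad/tridiag_posdef.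
pose z : 'cV[R]_N := \col_p if (p < m)%N then cofactor M l p else 0.
suff /matrixP/(_ k 0) : z = 0 by rewrite !mxE km.
apply: posdefmx_ker Mpos _.
rewrite -mulmxA mxE big1// => p _; rewrite !mxE; case: ifPn => pm; last by rewrite mul0r.
rewrite [X in _ * X](_ : _ = 0) ?mulr0//.
have := mul_mx_adj M => /matrixP/(_ p l); rewrite !mxE.
have -> : p == l = false by apply/negbTE; rewrite -val_eqE ltn_eqF// (ltn_trans pm).
rewrite mulr0n => E; rewrite -[RHS]E; apply: eq_bigr => q _; rewrite [z _ _]mxE [(\adj _) _ _]mxE.
(* For p < m <= q the entry (p, q) of M is zero: either q = m lies outside J, or p and q are not
   adjacent. *)
case: ifPn => //; rewrite -leqNgt => mq.
rewrite mulr0 [M _ _]mxE; have pq : (p < q)%N by exact: leq_trans mq.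
have npq : p == q = false by rewrite -val_eqE ltn_eqF.
case: ifPn => [/andP[pJ qJ]|_]; last by rewrite npq mul0r.
have mq' : (m < q)%N.
  by rewrite ltn_neqAle mq andbT val_eqE; apply: contraNneq mJ => ->.
rewrite mxE npq ltn_eqF ?(leq_ltn_trans pm mq')// gtn_eqF ?mul0r//.
by rewrite ltnS ltnW.
Qed.

End tridiagonal.

(** * The second differential as a variance *)

Section variance.
Context {R : realType} {I : finType}.
Variables (p X : I -> R).
Hypotheses (p0 : forall i, 0 <= p i) (p1 : \sum_i p i = 1).

Lemma varianceE (m := \sum_i p i * X i) :
  \sum_i p i * X i ^+ 2 - m ^+ 2 = \sum_i p i * (X i - m) ^+ 2.
Proof.
under [RHS]eq_bigr do rewrite sqrrB mulrDr mulrBr.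
rewrite big_split /= sumrB -mulr_suml p1 mul1r.
under [X in _ = _ - X + _]eq_bigr do rewrite -mulrnAr mulrA.
by rewrite -mulr_suml -/m mulrnAr -expr2 mulr2n opprD addrA subrK.
Qed.

Lemma variance_ge i : p i * (X i - \sum_i p i * X i) ^+ 2 <=
  \sum_i p i * X i ^+ 2 - (\sum_i p i * X i) ^+ 2.
Proof.
rewrite varianceE; set m := \sum_i p i * X i; rewrite (bigD1 i) //= lerDl sumr_ge0// => j _.
by rewrite mulr_ge0// sqr_ge0.
Qed.

End variance.

(** * Derivatives of the minors, and functionals dominated by the standard deviation *)

Section observed.
Context {R : realType} {N : nat}.
Implicit Types (L H : sym_matrix R N) (J : {set 'I_N}).

(** The differential of [pad_mx J] in direction H; the padding is constant and contributes 0. *)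
Definition pad_dir J H (k l : 'I_N) : R :=
  if (k \in J) && (l \in J) then sym_val H k l else 0.

Definition dminor L J H : R :=
  \sum_k \sum_l pad_dir J H k l * cofactor (pad_mx J L) k l.

(* By Jacobi's formula this is tr (L_J^-1 H_J). *)
Definition score L J H : R := dminor L J H / \det (principal_submx L J).

Definition score_variance L H : R :=
  \sum_J dpp_pmf L J * score L J H ^+ 2 - (\sum_J dpp_pmf L J * score L J H) ^+ 2.

Lemma is_diff_pad_entry L J (i j : 'I_N) :
  is_diff L (fun y : sym_matrix R N => pad_mx J y i j) (fun h => pad_dir J h i j).
Proof.
rewrite /pad_dir; under eq_fun do rewrite mxE.
case: (_ && _); first exact: is_diff_sym_coord.
exact: is_diff_cst.
Qed.

Lemma is_diff_minor L J :
  is_diff L (fun y : sym_matrix R N => \det (principal_submx y J)) (dminor L J).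
Proof.
have := is_diff_det (fun i j => is_diff_pad_entry L J i j).
have E y : \matrix_(i, j) pad_mx J y i j = pad_mx J y by apply/matrixP => i j; rewrite mxE.
under eq_fun do rewrite E -det_principal_submx.
by move=> /is_diff_eq; apply; apply/funext => h; rewrite E.
Qed.

Lemma differentiable_dminor L J H :
  differentiable (fun y : sym_matrix R N => dminor y J H) L.
Proof.
have cd (k l : 'I_N) : exists d, is_diff L (fun y : sym_matrix R N => cofactor (pad_mx J y) k l) d.
  eexists; rewrite /cofactor.
  have E (y : sym_matrix R N) : row' k (col' l (pad_mx J y)) =
    \matrix_(i, j) pad_mx J y (lift k i) (lift l j) by apply/matrixP => i j; rewrite !mxE.
  under eq_fun do rewrite E.
  apply/is_diffZ/(is_diff_det (fun i j => is_diff_pad_entry L J (lift k i) (lift l j))).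
(* The sum rule needs a family of differentials, chosen here for all cofactors at once. *)
have [d dP] := choice (fun kl : 'I_N * 'I_N => cd kl.1 kl.2).
have dk k : is_diff L (fun y : sym_matrix R N =>
    \sum_l pad_dir J H k l * cofactor (pad_mx J y) k l)
    (fun h => \sum_l pad_dir J H k l * d (k, l) h).
  apply: is_diff_sumf => l; exact: is_diffZ (dP (k, l)).
by have [] := is_diff_sumf (index_enum 'I_N) predT dk.
Qed.

Section at_posdef.
Variable (L : sym_matrix R N).
Hypothesis Lpos : posdefmx L.

Lemma minor_gt0 J : 0 < \det (principal_submx L J).
Proof. by rewrite det_principal_submx; exact/det_posdefmx_gt0/posdefmx_pad. Qed.

Lemma det_1D_gt0 : 0 < \det (1%:M + (L : 'M[R]_N)).
Proof.
rewrite det_1D_sum_principal (bigD1 finset.set0) //= ltr_pwDl ?minor_gt0// sumr_ge0// => J _.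
exact/ltW/minor_gt0.
Qed.

Lemma dpp_pmf_gt0 J : 0 < dpp_pmf L J.
Proof. by rewrite divr_gt0 ?minor_gt0 ?det_1D_gt0. Qed.

Lemma dpp_pmf_sum1 : \sum_J dpp_pmf L J = 1.
Proof. by rewrite -mulr_suml -det_1D_sum_principal divff// gt_eqF// det_1D_gt0. Qed.

Lemma second_diff_expected_loglik H :
  second_diff (expected_loglik L) L H H = - score_variance L H.
Proof.
have -> : expected_loglik L = fun y : sym_matrix R N =>
    \sum_J (\det (principal_submx L J) / \sum_K \det (principal_submx L K)) *
       ln (\det (principal_submx y J)) - ln (\sum_J \det (principal_submx y J)).
  by apply/funext => y; rewrite -!det_1D_sum_principal.
rewrite (second_diff_cross_entropy finset.set0 minor_gt0
   (fun J y => is_diff_minor y J) (fun J => differentiable_dminor L J H)).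
by rewrite /score_variance /dpp_pmf det_1D_sum_principal.
Qed.

Lemma score_variance_le H : score_variance L H <= \sum_J dpp_pmf L J * score L J H ^+ 2.
Proof. by rewrite lerBlDr lerDl sqr_ge0. Qed.

Lemma score_variance_ge0 H : 0 <= score_variance L H.
Proof.
rewrite /score_variance varianceE ?dpp_pmf_sum1// sumr_ge0// => J _.
by rewrite mulr_ge0 ?sqr_ge0// ltW// dpp_pmf_gt0.
Qed.

(** [C] is uniform in H and may have any sign, which makes the closure under linear combinations
    immediate. *)
Definition dominated (g : sym_matrix R N -> R) :=
  exists C, forall H, `|g H| <= C * Num.sqrt (score_variance L H).

Lemma dominated_scale (c : R) g : dominated g -> dominated (fun H => c * g H).
Proof.
by move=> [C gC]; exists (`|c| * C) => H; rewrite normrM -mulrA ler_wpM2l.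
Qed.

Lemma dominatedD g g' : dominated g -> dominated g' -> dominated (fun H => g H + g' H).
Proof.
move=> [C gC] [C' gC']; exists (C + C') => H.
by apply: le_trans (ler_normD _ _) _; rewrite mulrDl lerD.
Qed.

Lemma dominated_sum (I : Type) (r : seq I) (P : pred I) (g : I -> sym_matrix R N -> R) :
  (forall i, P i -> dominated (g i)) -> dominated (fun H => \sum_(i <- r | P i) g i H).
Proof.
move=> gP; elim: r => [|i r IH].
  by exists 0 => H; rewrite big_nil normr0 mul0r.
under eq_fun do rewrite big_cons.
have [Pi|_] := boolP (P i); first exact: dominatedD (gP i Pi) IH.
exact: IH.
Qed.

Lemma score_set0 H : score L finset.set0 H = 0.
Proof.
rewrite /score /dminor big1 ?mul0r// => k _; rewrite big1// => l _.
by rewrite /pad_dir finset.in_set0 mul0r.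
Qed.

(** One term of the variance controls each deviation from the mean. The score of the empty set is 0,
    so subtracting its deviation removes the mean. *)
Lemma dominated_score J : dominated (score L J).
Proof.
have dev K : exists C, forall H,
    `|score L K H - \sum_J dpp_pmf L J * score L J H| <= C * Num.sqrt (score_variance L H).
  exists (Num.sqrt (dpp_pmf L K))^-1 => H.
  have sp : 0 < Num.sqrt (dpp_pmf L K) by rewrite sqrtr_gt0 dpp_pmf_gt0.
  rewrite mulrC ler_pdivlMr// -sqrtr_sqr mulrC -sqrtrM ?(ltW (dpp_pmf_gt0 _))//.
  rewrite ler_wsqrtr// variance_ge ?dpp_pmf_sum1// => i; exact/ltW/dpp_pmf_gt0.
have [C CP] := dev J; have [D DP] := dev finset.set0; exists (C + D) => H.
have := lerD (CP H) (DP H); rewrite -mulrDl; apply: le_trans.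
apply: le_trans (ler_normB _ _); rewrite score_set0 sub0r opprK subrK//.
Qed.

Lemma dominated_dminor J : dominated (dminor L J).
Proof.
have -> : dminor L J = fun H => \det (principal_submx L J) * score L J H.
  by apply/funext => H; rewrite /score mulrC divfK// gt_eqF// minor_gt0.
exact/dominated_scale/dominated_score.
Qed.

End at_posdef.
End observed.

(** * Bounds for tridiagonal matrices *)

Lemma sym_valC (R : realType) N (H : sym_matrix R N) i j : sym_val H i j = sym_val H j i.
Proof.
have := sym_valP H; rewrite sym_predE => /eqP E.
by rewrite [in LHS]E mxE.
Qed.

Lemma cofactor_padC (R : realType) N (H : sym_matrix R N) (J : {set 'I_N}) i j :
  cofactor (pad_mx J H) i j = cofactor (pad_mx J H) j i.
Proof.
rewrite -cofactor_tr; congr (cofactor _ _ _); apply/matrixP => k l; rewrite !mxE.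
by rewrite andbC eq_sym sym_valC.
Qed.

Section tridiagonal.
Context {R : realType} {a b : R}.
Hypotheses (ha : 0 < a) (hb : b != 0) (hab : 4 * b ^+ 2 < a ^+ 2).
Variable N : nat.

Let L := tridiag N a b.

Let Lpos : posdefmx L.
Proof. exact: tridiag_posdef. Qed.

Lemma dominated_entry (i j : 'I_N) : dominated L (fun H => sym_val H i j).
Proof.
wlog ij : i j / (i <= j)%N.
  move=> wl; have [/wl//|/ltnW/wl] := leqP i j.
  by under [in X in _ -> X]eq_fun do rewrite sym_valC.
(* Strong induction on the distance from the diagonal. *)
have [d] := ubnP (j - i); elim: d => // d IH in i j ij *; rewrite ltnS => jid.
pose J := [set k : 'I_N | (i <= k <= j)%N]%SET.
pose M := pad_mx J L.
(* There are one or two corners according to whether i = j; the cardinal in [c] treats both cases at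
   once. *)
pose corner (p : 'I_N * 'I_N) := (p == (i, j)) || (p == (j, i)).
pose c := cofactor M j i *+ #|corner|.
have c0 : c != 0.
  rewrite mulrn_eq0 negb_or (tridiag_cofactor_neq0 ha hb hab ij) andbT -lt0n.
  by apply/card_gt0P; exists (i, j); rewrite unfold_in /corner eqxx.
have dE (H : sym_matrix R N) : dminor L J H = sym_val H i j * c +
    \sum_(p | ~~ corner p) pad_dir J H p.1 p.2 * cofactor M p.1 p.2.
  rewrite /dminor pair_bigA (bigID corner) /=; congr (_ + _).
  rewrite (eq_bigr (fun=> sym_val H i j * cofactor M j i)) ?sumr_const ?mulrnAr// => p.
  have iJ : i \in J by rewrite inE leqnn ij.
  have jJ : j \in J by rewrite inE leqnn ij.
  case/orP => /eqP -> /=; rewrite /pad_dir iJ jJ /=; last by rewrite sym_valC.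
  by rewrite cofactor_padC.
have -> : (fun H : sym_matrix R N => sym_val H i j) = fun H => c^-1 * (dminor L J H +
    -1 * \sum_(p | ~~ corner p) pad_dir J H p.1 p.2 * cofactor M p.1 p.2).
  by apply/funext => H; rewrite dE mulN1r addrK mulrC mulfK.
apply: dominated_scale; apply: dominatedD; first exact: dominated_dminor.
apply: dominated_scale; apply: dominated_sum => -[k l] /= ncorner.
under eq_fun do rewrite mulrC; apply: dominated_scale.
rewrite /pad_dir; have [|_] := boolP ((k \in J) && (l \in J)); last first.
  by exists 0 => H; rewrite normr0 mul0r.
rewrite !inE => /andP[/andP[ik kj] /andP[il lj]].
(* A pair inside [i, j] other than (i, j) itself is at smaller distance, so the induction hypothesis
   applies. *)
have small (u v : 'I_N) : (u <= v)%N -> (i <= u)%N -> (v <= j)%N -> (u, v) != (i, j) ->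
    dominated L (fun H => sym_val H u v).
  move=> uv iu vj uvij; apply: IH => //.
  apply: leq_trans jid; rewrite ltn_neqAle leq_sub// andbT.
  apply: contra uvij => /eqP e; rewrite xpair_eqE -!val_eqE /=.
  have ju : (v - u + u = v)%N by exact: subnK.
  have ji : (j - i + i = j)%N by exact: subnK.
  lia.
move: ncorner; rewrite negb_or => /andP[n1 n2].
have [kl|/ltnW lk] := leqP k l; first exact: small.
under eq_fun do rewrite sym_valC.
apply: small => //; apply: contra n2; rewrite !xpair_eqE => /andP[-> ->]//.
Qed.

Lemma score_variance_lbound : exists2 e : R, 0 < e &
  forall H, frobenius_norm (sym_val H) = 1 -> e <= score_variance L H.
Proof.
have [C CP] : dominated L (fun H => \sum_i \sum_j `|sym_val H i j|).
  apply: dominated_sum => i _; apply: dominated_sum => j _.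
  by have [C CP] := dominated_entry i j; exists C => H; rewrite normr_id.
have C1 : 0 < `|C| + 1 by rewrite ltr_wpDl.
(* Replacing [C] by [|C| + 1] makes the constant positive, hence invertible. *)
exists ((`|C| + 1) ^- 2); first by rewrite invr_gt0 exprn_gt0.
move=> H H1; have Q0 := score_variance_ge0 Lpos H.
(* All entries of H are at most 1 in absolute value, so they dominate their squares, whose sum is
   1. *)
have S1 : 1 <= \sum_i \sum_j `|sym_val H i j|.
  have -> : 1 = \sum_i \sum_j sym_val H i j ^+ 2.
    rewrite -[RHS]sqr_sqrtr; last first.
      by apply: sumr_ge0 => i _; apply: sumr_ge0 => j _; exact: sqr_ge0.
    by rewrite -/(frobenius_norm _) H1 expr1n.
  apply: ler_sum => i _; apply: ler_sum => j _.
  rewrite -[_ ^+ 2]ger0_norm ?sqr_ge0// normrX expr2 ler_piMr//.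
  by have := sym_coord_le_norm H i j; rewrite sym_normE H1.
have := le_trans S1 (le_trans (ler_norm _) (CP H)).
move=> S2; have {}S2 : 1 <= (`|C| + 1) * Num.sqrt (score_variance L H).
  apply: le_trans S2 _; rewrite ler_wpM2r ?sqrtr_ge0//.
  by apply: le_trans (ler_norm C) _; rewrite lerDl.
rewrite -(sqr_sqrtr Q0) -exprVn lerXn2r ?nnegrE ?invr_ge0 ?sqrtr_ge0 ?(ltW C1)//.
by rewrite -[leLHS]mul1r ler_pdivrMr// mulrC.
Qed.
End tridiagonal.

(** * Upper bound along a direction supported on the two corners *)

Lemma exists_sym_unit_corner (R : realType) (N : nat) (i j : 'I_N) :
  exists H : sym_matrix R N, frobenius_norm (sym_val H) = 1 /\
    forall k l, (k, l) != (i, j) -> (k, l) != (j, i) -> sym_val H k l = 0.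
Proof.
pose A : 'M[R]_N := \matrix_(k, l) (((k, l) == (i, j)) || ((k, l) == (j, i)))%:R.
have As : A \in @sym_pred R N.
  rewrite sym_predE; apply/eqP/matrixP => k l; rewrite !mxE !xpair_eqE.
  by rewrite orbC andbC (andbC (k == i)).
pose B := SymMatrix A As.
have B0 : `|B| != 0.
  rewrite normr_eq0; apply/eqP => /(congr1 (fun M => sym_val M i j)).
  by rewrite /= !mxE eqxx => /eqP; rewrite oner_eq0.
exists (`|B|^-1 *: B); split.
  by rewrite -sym_normE normrZ normfV normr_id mulVf.
move=> k l /negbTE kl /negbTE lk.
by rewrite /= !mxE kl lk mulr0.
Qed.

Section tridiagonal.
Context {R : realType} {a b : R}.
Hypotheses (ha : 0 < a) (hb : b != 0) (hab : 4 * b ^+ 2 < a ^+ 2).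
Variable n : nat.

Let L := tridiag n.+1 a b.

Let Lpos : posdefmx L.
Proof. exact: tridiag_posdef. Qed.

Variable H : sym_matrix R n.+1.
Hypothesis H1 : frobenius_norm (sym_val H) = 1.
Hypothesis H_corner : forall k l,
  (k, l) != (ord0, ord_max) -> (k, l) != (ord_max, ord0) -> sym_val H k l = 0.

Lemma dminor_corner (J : {set 'I_n.+1}) : J != [set: 'I_n.+1]%SET -> dminor L J H = 0.
Proof.
move=> JT; have [m mJ] : exists m, m \notin J.
  apply/existsP; rewrite -negb_forall; apply: contra JT => /forallP JT.
  by apply/eqP/setP => m; rewrite JT finset.in_setT.
rewrite /dminor big1// => k _; rewrite big1// => l _; rewrite /pad_dir.
case: ifPn => [/andP[kJ lJ]|_]; last by rewrite mul0r.
(* Once both end indices belong to J, the missing index m lies strictly between them. *)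
have gap (u v : 'I_n.+1) : (u, v) = (ord0, ord_max) -> u \in J -> v \in J ->
    cofactor (pad_mx J L) v u = 0.
  move=> [-> ->] uJ vJ; apply: (tridiag_cofactor_gap ha hab mJ).
    by rewrite lt0n; apply: contraNneq mJ => m0; rewrite (_ : m = ord0)//; exact: val_inj.
  rewrite ltn_neqAle -ltnS ltn_ord andbT; apply: contraNneq mJ => mn.
  by rewrite (_ : m = ord_max)//; exact: val_inj.
have [e|n1] := eqVneq (k, l) (ord0, ord_max).
  by rewrite cofactor_padC gap ?mulr0.
have [[e1 e2]|n2] := eqVneq (k, l) (ord_max, ord0).
  by rewrite gap ?mulr0// e1 e2.
by rewrite H_corner ?mul0r.
Qed.

Lemma score_setT_le : `|score L [set: 'I_n.+1]%SET H| <= 2 * (`|b| ^+ n / (a / 2) ^+ n.+1).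
Proof.
set T := [set: 'I_n.+1]%SET.
have r0 : 0 < a / 2 by rewrite divr_gt0.
have dT := minor_gt0 Lpos T.
rewrite normrM normfV (gtr0_norm dT) ler_pdivrMr//.
have cof_le : `|cofactor (pad_mx T L) ord_max ord0| <=
    `|b| ^+ n / (a / 2) ^+ n.+1 * \det (principal_submx L T).
  rewrite mulrAC ler_pdivlMr ?exprn_gt0// mulrC.
  have := tridiag_cofactor_le ha hab (leq0n (@ord_max n) : (@ord0 n <= @ord_max n)%N).
  have -> : [set k : 'I_n.+1 | (@ord0 n <= k <= @ord_max n)%N]%SET = T.
    by apply/setP => k; rewrite !inE /= -ltnS ltn_ord.
  by rewrite subn0 -[pad_mx T (tridiag_mx _ _ _)]/(pad_mx T L) -det_principal_submx (gtr0_norm dT).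
have cof_le' := cof_le; rewrite cofactor_padC in cof_le'.
have H_le k l : `|sym_val H k l| <= 1.
  by have := sym_coord_le_norm H k l; rewrite sym_normE H1.
pose corner (p : 'I_n.+1 * 'I_n.+1) := (p == (ord0, ord_max)) || (p == (ord_max, ord0)).
rewrite /dminor pair_bigA (bigID corner) /= [X in _ + X]big1 ?addr0; last first.
  move=> [k l]; rewrite negb_or => /andP[n1 n2].
  by rewrite /pad_dir !finset.in_setT /= H_corner ?mul0r.
apply: le_trans (ler_norm_sum _ _ _) _.
(* Source of the factor 2; the two corners coincide when n = 0. *)
have card2 : (#|corner| <= 2)%N.
  have := cards2 (@ord0 n, @ord_max n) (@ord_max n, @ord0 n).
  rewrite -(ltnS _ 2) => e; apply: (@leq_ltn_trans #|[set (@ord0 n, @ord_max n); (@ord_max n, @ord0 n)]%SET|).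
    by apply/subset_leq_card/fintype.subsetP => p; rewrite unfold_in finset.in_set2.
  by rewrite e; case: (_ == _).
apply: (@le_trans _ _ (\sum_(p | corner p)
    (`|b| ^+ n / (a / 2) ^+ n.+1 * \det (principal_submx L T)))).
  apply: ler_sum => p /orP[]/eqP -> /=; rewrite normrM /pad_dir !finset.in_setT /=;
    rewrite -[leRHS]mul1r; apply: ler_pM => //; by [exact: H_le | exact: cof_le | exact: cof_le'].
rewrite sumr_const -[leLHS]mulr_natl -[leRHS]mulrA ler_wpM2r ?ler_nat//.
by rewrite mulr_ge0 ?(ltW dT)// divr_ge0 ?exprn_ge0// ltW.
Qed.

(** Only the full set contributes to the second moment, with weight at most 1; the bound is the
    square of that of [score_setT_le]. *)
Lemma score_variance_corner_le :
  score_variance L H <= 4 / b ^+ 2 * (4 * b ^+ 2 / a ^+ 2) ^+ n.+1.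
Proof.
apply: le_trans (score_variance_le L H) _.
rewrite (bigD1 [set: 'I_n.+1]%SET) //= big1 ?addr0 => [|J JT]; last first.
  by rewrite /score dminor_corner// mul0r expr0n mulr0.
set T := [set: 'I_n.+1]%SET.
have p1 : dpp_pmf L T <= 1.
  rewrite -(dpp_pmf_sum1 Lpos) (bigD1 T) //= lerDl sumr_ge0// => J _.
  exact/ltW/dpp_pmf_gt0.
apply: (@le_trans _ _ (`|score L T H| ^+ 2)).
  by rewrite real_normK ?num_real// ler_piMl ?sqr_ge0.
apply: le_trans (_ : (2 * (`|b| ^+ n / (a / 2) ^+ n.+1)) ^+ 2 <= _).
  by rewrite lerXn2r ?nnegrE ?score_setT_le// mulr_ge0// divr_ge0 ?exprn_ge0// divr_ge0// ltW.
have bE : `|b| ^+ 2 = b ^+ 2 by rewrite real_normK ?num_real.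
rewrite le_eqVlt; apply/orP; left; apply/eqP.
rewrite exprMn expr_div_n [(`|b| ^+ n) ^+ 2]exprAC bE [(_ ^+ n.+1) ^+ 2]exprAC.
have -> : (a / 2) ^+ 2 = a ^+ 2 / 4 by field.
rewrite !expr_div_n [(4 * b ^+ 2) ^+ n.+1]exprMn (exprS (b ^+ 2)).
have a0 : (a ^+ 2) ^+ n.+1 != 0 by rewrite !expf_neq0// gt_eqF.
have q0 : 4 ^+ n.+1 != 0 :> R by rewrite expf_neq0// pnatr_eq0.
(* The powers are generalised so that [field] treats them as atoms. *)
move: a0 q0; move: (_ ^+ n.+1) (4 ^+ n.+1) (_ ^+ n) => A Q P A0 Q0.
by field; rewrite A0 Q0 hb.
Qed.

End tridiagonal.

(** * Passage to the infimum and the exponential rate *)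

Unset Implicit Arguments.

Theorem proposition9 (R : realType) (a b : R) (ha : 0 < a) (hb : b != 0)
    (hab : 4 * b ^+ 2 < a ^+ 2) :
  (forall N : nat, (0 < N)%N -> posdefmx (tridiag N a b)) /\
  exists c1 c2 : R, [/\ 0 < c1, 0 < c2 &
    forall N : nat, (0 < N)%N ->
      let Lstar := tridiag N a b in
      let Phi := expected_loglik Lstar in
      let m := inf [set - second_diff Phi Lstar H H |
                     H in [set H : sym_matrix R N | frobenius_norm H = 1]] in
      0 < m /\ m <= c1 * expR (- c2 * N%:R)].
Proof.
split=> [N _|]; first exact: tridiag_posdef.
have b2 : 0 < b ^+ 2 by rewrite exprn_even_gt0.
have a2 : 0 < a ^+ 2 by rewrite exprn_gt0.
(* The inverse of the decay ratio per dimension; q > 1 makes [ln q] a positive rate. *)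
pose q := a ^+ 2 / (4 * b ^+ 2).
have q1 : 1 < q by rewrite ltr_pdivlMr ?mul1r// mulr_gt0.
have q0 : 0 < q by exact: lt_trans q1.
exists (4 / b ^+ 2), (ln q); split; [by rewrite divr_gt0|exact: ln_gt0|].
case=> // n _ L Phi m.
have Lpos : posdefmx L by exact: tridiag_posdef.
have [H0 [H01 H0c]] := exists_sym_unit_corner R (@ord0 n) (@ord_max n).
have [e e0 eP] := score_variance_lbound ha hb hab n.+1.
have lb : lbound [set - second_diff Phi L H H | H in
    [set H : sym_matrix R n.+1 | frobenius_norm H = 1]] e.
  by move=> _ [H H1 <-]; rewrite second_diff_expected_loglik// opprK eP.
split.
  (* A lower bound passes to [inf] only for a nonempty set, whence the witness [H0]. *)
  apply: lt_le_trans e0 _; apply: lb_le_inf lb.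
  by exists (- second_diff Phi L H0 H0), H0.
apply: le_trans (_ : score_variance L H0 <= _).
  apply: ge_inf; first by exists e.
  by exists H0 => //; rewrite second_diff_expected_loglik// opprK.
apply: le_trans (score_variance_corner_le ha hb hab H01 H0c) _.
by rewrite -lnV ?posrE// [_ * n.+1%:R]mulrC expRM_natl lnK ?posrE ?invr_gt0// invf_div.
Qed.
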